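(* Let $X$ be a completely regular space which is locally null with respect to an ideal $\mathfrak{I}$ in $X$. Then $C^{\mathfrak I}_0(X)$ is a closed ideal of $C_B(X)$ which is isometrically isomorphic (as a normed algebra) to $C_0(Y)$ for some locally compact space $Y$, namely for $Y=\lambda_{\mathfrak I}X$. The space $Y$ is unique up to homeomorphism and coincides with the spectrum of $C^{\mathfrak I}_0(X)$. Furthermore: (1) $X$ is contained in $Y$ as a dense subspace. (2) $C^{\mathfrak I}_0(X)$ is non-vanishing. (3) $C^{\mathfrak I}_{00}(X)$ is dense in $C^{\mathfrak I}_0(X)$, if $X$ is moreover normal. (4) The following are equivalent: $C^{\mathfrak I}_0(X)$ is unital; $\mathfrak I$ is non-proper; $Y$ is compact.
   Context: Completely regular, compact and locally compact spaces are assumed to be Hausdorff. The scalar field is $\mathbb{C}$. $C_B(X)$ is the normed algebra of continuous bounded $f:X\to\mathbb{C}$ with the supremum norm. For continuous $f:X\to\mathbb{C}$, $\mathrm{coz}(f)=X\setminus f^{-1}(0)$ and $\mathrm{supp}(f)=\mathrm{cl}_X\mathrm{coz}(f)$; $\mathrm{Coz}(X)$ is the set of all cozero-sets $\mathrm{coz}(f)$ of $X$. $C_0(Y)$ is the set of $f\in C_B(Y)$ such that $|f|^{-1}([1/n,\infty))$ is compact for each positive integer $n$. $\beta X$ is the Stone–Čech compactification of $X$, with $X\subseteq\beta X$. The spectrum is the Gelfand spectrum (of a commutative $C^*$-algebra). An ideal $\mathfrak I$ in a set $X$ is a non-empty collection of subsets of $X$ closed under taking subsets and finite unions; its elements are called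 null sets; $\mathfrak I$ is proper if $X$ is not null (non-proper otherwise). A neighborhood of $A\subseteq X$ in $X$ is a set $U\subseteq X$ with $A\subseteq\mathrm{int}_XU$. A space $X$ is locally null (with respect to $\mathfrak I$) if each point of $X$ has a null neighborhood in $X$. Define $$C^{\mathfrak I}_{00}(X)=\{f\in C_B(X):\mathrm{supp}(f)\text{ has a null neighborhood in }X\},$$ $$C^{\mathfrak I}_0(X)=\{f\in C_B(X):|f|^{-1}([1/n,\infty))\text{ is null for each positive integer }n\},$$ $$\lambda_{\mathfrak I}X=\bigcup\{\mathrm{int}_{\beta X}\mathrm{cl}_{\beta X}C:C\in\mathrm{Coz}(X)\text{ and }\mathrm{cl}_XC\text{ has a null neighborhood in }X\}\subseteq\beta X.$$ An ideal $H$ of $C_B(X)$ is non-vanishing if for every $x\in X$ there is $h\in H$ with $h(x)\neq0$. An ideal of $C_B(X)$ is unital if, as an algebra, it has a multiplicative identity. *)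

(* Defs.v *)
(* MathComp-Analysis *)
From HB Require Import structures.
From mathcomp Require Import all_boot all_order all_algebra.
From mathcomp Require Import all_classical all_reals all_analysis.
From mathcomp Require Import complex.

Set Implicit Arguments.
Unset Strict Implicit.
Unset Printing Implicit Defensive.

Import Order.TTheory GRing.Theory Num.Theory.
Import numFieldNormedType.Exports.

Local Open Scope classical_set_scope.
Local Open Scope ring_scope.

(* The complex numbers, packaged as a numClosedFieldType.  On the bare type
   [R[i]] the inferred module structure would be the one over [R]; going through
   the package gives the topology, norm and module structure over C itself.
   The modulus is C-valued, with values on the nonnegative real axis; as
   [x <= y] in C implies that [y - x] is real, comparing moduli in C is the
   usual comparison of real numbers. *)
Definition Cplx (R : realType) : numClosedFieldType := R[i]%C.

Section BoundedContinuous.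
Variables (X : topologicalType) (R : realType).
Local Notation C := (Cplx R).

Definition bounded_continuous : {pred X -> C} :=
  fun f => `[< continuous f /\ bounded_fun f >].

Record CB := MkCB { CBfun :> X -> C; _ : CBfun \in bounded_continuous }.

HB.instance Definition _ := [isSub for CBfun].
HB.instance Definition _ := [Choice of CB by <:].

Lemma bounded_continuousP (f : X -> C) : f \in bounded_continuous <->
  continuous f /\ exists2 M : C, 0 <= M & forall x, `|f x| <= M.
Proof.
rewrite unfold_in; split=> [/asboolP[cf]|[cf [M M0 fM]]].
  move=> /pinfty_ex_gt0[M M0 fM]; split=> //.
  by exists M; [exact: ltW | move=> x; exact: fM].
apply/asboolP; split => //; exists M; split; first exact: ger0_real.
by move=> y My x _ /=; exact: le_trans (fM x) (ltW My).
Qed.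

Let subring_bc : subring_closed bounded_continuous.
Proof.
split => [|f g|f g].
- apply/bounded_continuousP; split; first by move=> x; exact: cvg_cst.
  by exists 1; [exact: ler01 | move=> x; rewrite normr1 lexx].
- move=> /bounded_continuousP[cf [M M0 fM]] /bounded_continuousP[cg [N N0 gN]].
  apply/bounded_continuousP; split; first by move=> x; apply: (cvgB (cf x) (cg x)).
  exists (M + N); first exact: addr_ge0.
  by move=> x; apply: le_trans (ler_normB _ _) _; exact: lerD.
- move=> /bounded_continuousP[cf [M M0 fM]] /bounded_continuousP[cg [N N0 gN]].
  apply/bounded_continuousP; split; first by move=> x; apply: (cvgM (cf x) (cg x)).
  exists (M * N); first exact: mulr_ge0.
  by move=> x; rewrite normrM ler_pM.
Qed.

Let submod_bc : submod_closed bounded_continuous.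
Proof.
split => [|a f g].
  apply/bounded_continuousP; split; first by move=> x; exact: cvg_cst.
  by exists 0; [exact: lexx | move=> x; rewrite normr0 lexx].
move=> /bounded_continuousP[cf [M M0 fM]] /bounded_continuousP[cg [N N0 gN]].
apply/bounded_continuousP; split.
  by move=> x; exact: (cvgD (cvgM (cvg_cst a) (cf x)) (cg x)).
exists (`|a| * M + N); first by rewrite addr_ge0// mulr_ge0.
move=> x; apply: le_trans (ler_normD _ _) _; apply: lerD => //.
by rewrite normrM ler_wpM2l.
Qed.

HB.instance Definition _ :=
  GRing.SubChoice_isSubComPzRing.Build _ _ CB subring_bc.
HB.instance Definition _ :=
  GRing.SubZmodule_isSubLmodule.Build _ _ _ CB (GRing.submod_closed_semi submod_bc).

(* The supremum norm; it is 0 when X is empty. *)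
Definition CBnorm (f : CB) : C := (sup [set complex.Re `|f x| | x in setT])%:C%C.

Lemma CBP (f : CB) :
  continuous f /\ exists2 M : C, 0 <= M & forall x, `|f x| <= M.
Proof. by apply/bounded_continuousP; case: f. Qed.

Lemma normCR (z : C) : (complex.Re `|z|)%:C%C = `|z|.
Proof. exact/RRe_real/normr_real. Qed.

Lemma CBnorm_ub (f : CB) x : `|f x| <= CBnorm f.
Proof.
rewrite -(normCR (f x)) /CBnorm lecR; apply: ub_le_sup; last by exists x.
have [_ [M M0 fM]] := CBP f; exists (complex.Re M) => _ [y _ <-].
by rewrite -lecR normCR RRe_real ?ger0_real.
Qed.

Lemma CBnorm_le (f : CB) (M : C) : 0 <= M -> (forall x, `|f x| <= M) ->
  CBnorm f <= M.
Proof.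
move=> M0 fM; rewrite -(RRe_real (ger0_real M0)) lecR.
have [[y [x _ xy]]|/set0P/negP/negPn/eqP ->] :=
  pselect ([set complex.Re `|f x| | x in setT] !=set0).
  apply: ge_sup; first by exists y, x.
  by move=> _ [z _ <-]; rewrite -lecR normCR RRe_real ?ger0_real.
by rewrite sup0 -lecR RRe_real ?ger0_real.
Qed.

Lemma CBnorm_ge0 (f : CB) : 0 <= CBnorm f.
Proof.
have [[x _]|/set0P/negP/negPn/eqP X0] := pselect ([set: X] !=set0).
  exact: le_trans (CBnorm_ub f x).
by rewrite /CBnorm X0 image_set0 sup0.
Qed.

Let CBnormD (f g : CB) : CBnorm (f + g) <= CBnorm f + CBnorm g.
Proof.
apply: CBnorm_le => [|x]; first by rewrite addr_ge0 ?CBnorm_ge0.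
by apply: le_trans (ler_normD (f x) (g x)) _; rewrite lerD ?CBnorm_ub.
Qed.

Let CBnormZ (a : C) (f : CB) : CBnorm (a *: f) = `|a| * CBnorm f.
Proof.
apply/eqP; rewrite eq_le; apply/andP; split.
  apply: CBnorm_le => [|x]; first by rewrite mulr_ge0 ?CBnorm_ge0.
  by rewrite normrM ler_wpM2l ?CBnorm_ub.
have [->|a0] := eqVneq a 0; first by rewrite normr0 mul0r CBnorm_ge0.
rewrite -ler_pdivlMl ?normr_gt0//; apply: CBnorm_le => [|x].
  by rewrite mulr_ge0 ?CBnorm_ge0 ?invr_ge0.
by rewrite ler_pdivlMl ?normr_gt0// -normrM; exact: (CBnorm_ub (a *: f)).
Qed.

Let CBnorm_eq0 (f : CB) : CBnorm f = 0 -> f = 0.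
Proof.
move=> f0; apply: val_inj; apply/funext => x; apply/eqP; rewrite -normr_le0.
by rewrite -f0; exact: CBnorm_ub.
Qed.

HB.instance Definition _ :=
  @Lmodule_isNormed.Build C CB CBnorm CBnormD CBnormZ CBnorm_eq0.

Lemma CB_normE (f : CB) : `|f| = CBnorm f. Proof. by []. Qed.

Lemma CB_normM (f g : CB) : `|f * g| <= `|f| * `|g|.
Proof.
rewrite !CB_normE; apply: CBnorm_le => [|x]; first by rewrite mulr_ge0 ?CBnorm_ge0.
by rewrite normrM ler_pM// CBnorm_ub.
Qed.

Lemma CB_scalerAl (a : C) (f g : CB) : a *: (f * g) = (a *: f) * g.
Proof. by apply: val_inj; apply/funext => x; exact: mulrA. Qed.

End BoundedContinuous.

Section Embeddings.
Variables (S T : topologicalType).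

Definition topological_embedding (f : S -> T) :=
  injective f /\ open = [set f @^-1` V | V in open].

Definition homeomorphic := exists (f : S -> T) (g : T -> S),
  [/\ continuous f, continuous g, cancel f g & cancel g f].

End Embeddings.

(* Tychonoff's construction of the Stone-Cech compactification: the closure of
   the image of X under evaluation in the power of the real line indexed by the
   continuous functions from X to [0, 1]. *)
Section StoneCech.
Variables (R : realType) (X : topologicalType).

Definition unit_functions : set (X -> R) :=
  [set f : X -> R | continuous f /\ range f `<=` `[0, 1]].

Definition unit_eval (x : X) : {ptws unit_functions -> R} :=
  fun f => set_val f x.

Definition stone_cech : topologicalType :=
  set_type (closure (range unit_eval)).

Definition to_stone_cech (x : X) : stone_cech :=
  SigSub (mem_set (subset_closure (imageT unit_eval x))).

Lemma unit_eval_continuous : continuous unit_eval.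
Proof.
move=> x; apply/cvg_sup => f U [_ [[V oV <-] /= Vfx] VU].
apply: filterS VU _; have [cf _] := set_valP f.
by apply: cf; exact: open_nbhs_nbhs.
Qed.

Lemma stone_cech_hausdorff : hausdorff_space stone_cech.
Proof.
move=> p q pq; apply: val_inj.
suff : cluster (nbhs (val p)) (val q).
  apply: hausdorff_product => _; exact: Rhausdorff.
move=> A B Ap Bq.
have cv : continuous (set_val : stone_cech -> {ptws unit_functions -> R}).
  exact: initial_continuous.
have [r [Ar Br]] := pq _ _ (cv _ _ Ap) (cv _ _ Bq).
by exists (val r).
Qed.

Lemma stone_cech_compact : compact [set: stone_cech].
Proof.
have cube := @tychonoff unit_functions (fun=> R) (fun=> `[0, 1]%classic)
  (fun=> @segment_compact R 0 1).
have hcube := @hausdorff_product unit_functions (fun=> R) (fun=> @Rhausdorff R).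
have cK : compact (closure (range unit_eval)).
  apply: (subclosed_compact _ cube); first exact: closed_closure.
  rewrite closureE; apply: smallest_sub; first exact: compact_closed hcube cube.
  by move=> _ [x _ <-] f; have [_] := set_valP f; apply; exists x.
move=> F FF _.
have [|p [Kp clp]] := cK (set_val @ F).
  apply: (@filterS _ F _ setT _ _ filterT) => x _.
  exact: (@set_valP _ (closure (range unit_eval)) x).
exists (SigSub (mem_set Kp)); split => // A B FA [_ [[V oV <-] /= Vp] VB].
have [||_ [[a Aa <-] Va]] := clp (set_val @` A) V.
- by apply: (@filterS _ F _ A _ _ FA) => x Ax; exists x.
- by apply: open_nbhs_nbhs; split.
by exists a; split => //; exact: VB.
Qed.

Lemma to_stone_cech_dense : dense (range to_stone_cech).
Proof.
move=> O [p Op] [V oV VE].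
have Vp : V (set_val p) by move: Op; rewrite -VE.
have Kp : closure (range unit_eval) (set_val p).
  exact: (@set_valP _ (closure (range unit_eval)) p).
have [_ [[x _ <-] Vx]] := Kp V (open_nbhs_nbhs (conj oV Vp)).
by exists (to_stone_cech x); split; [rewrite -VE | exists x].
Qed.

Lemma to_stone_cech_embedding : hausdorff_space X ->
  completely_regular_space X -> topological_embedding to_stone_cech.
Proof.
move=> hX crX.
pose f_ (i : unit_functions) : X -> R := set_val i.
have cf i : continuous (f_ i) by have [] := set_valP i.
have sep : separate_points_from_closed f_.
  move=> U x cU Ux.
  have /(@uniform_separatorP _ R)[f [cf' f01 fx fU]] := crX x U cU Ux.
  exists (SigSub (mem_set (conj cf' f01 : unit_functions f))) => /=.
  have -> : f_ (SigSub (mem_set (conj cf' f01 : unit_functions f))) = f by [].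
  move=> /(closureS fU).
  rewrite -(closure_id _).1; last first.
    exact: accessible_closed_set1 (hausdorff_accessible (@Rhausdorff R)) _.
  have -> : f x = 0 by apply: fx; exists x.
  by move=> /= /esym/eqP; rewrite oner_eq0.
have inj := join_product_inj sep (hausdorff_accessible hX).
split.
  move=> x y xy; apply: inj; rewrite ?inE//.
  exact: (congr1 val xy).
rewrite (join_product_initial sep cf inj).
apply/seteqP; split => U.
  by move=> [V oV <-]; exists (set_val @^-1` V) => //; exists V.
by move=> [_ [V oV <-] <-]; exists V.
Qed.

Lemma stone_cech_extension (f : X -> R) : unit_functions f ->
  exists2 g : stone_cech -> R,
    continuous g & forall x, g (to_stone_cech x) = f x.
Proof.
move=> uf; pose i : unit_functions := SigSub (mem_set uf).
exists (fun p => val p i) => // p.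
apply: (@continuous_comp _ _ _ set_val
  (fun h : {ptws unit_functions -> R} => h i)).
  exact: initial_continuous.
exact: proj_continuous.
Qed.

End StoneCech.

Arguments to_stone_cech R {X} x.

Section NullSets.
Variables (R : realType) (X : topologicalType) (I : set_system X).
Local Notation C := (Cplx R).

Definition set_ideal := [/\ I !=set0,
  forall A B, A `<=` B -> I B -> I A & forall A B, I A -> I B -> I (A `|` B)].

Definition has_null_neighborhood (A : set X) := exists2 U, I U & A `<=` interior U.

Definition locally_null := forall x, has_null_neighborhood [set x].

Definition coz (f : X -> C) : set X := [set x | f x != 0].

Definition supp (f : X -> C) : set X := closure (coz f).

Definition cozero_sets : set_system X := [set coz f | f in [set f : X -> C | continuous f]].

Definition C00_null : set (CB X R) := [set f | has_null_neighborhood (supp f)].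

Definition C0_null : set (CB X R) :=
  [set f | forall n : nat, (0 < n)%N -> I [set x | n%:R^-1 <= `|f x|]].

Definition lambda_null : set (stone_cech R X) :=
  \bigcup_(A in [set A | cozero_sets A /\ has_null_neighborhood (closure A)])
    interior (closure (to_stone_cech R @` A)).

End NullSets.

Arguments C00_null R [X] I.
Arguments C0_null R [X] I.
Arguments lambda_null R [X] I.

Section FunctionAlgebras.
Variable R : realType.
Local Notation C := (Cplx R).

Definition C0 (Y : topologicalType) : set (CB Y R) :=
  [set f | forall n : nat, (0 < n)%N -> compact [set y | n%:R^-1 <= `|f y|]].

Definition algebra_ideal (X : topologicalType) (H : set (CB X R)) :=
  [/\ H 0, forall f g, H f -> H g -> H (f + g), forall a f, H f -> H (a *: f)
    & forall f g, H f -> H (g * f)].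

Definition non_vanishing (X : topologicalType) (H : set (CB X R)) :=
  forall x, exists2 h, H h & h x != 0.

Definition unital (X : topologicalType) (H : set (CB X R)) :=
  exists2 u, H u & forall h, H h -> u * h = h.

(* Only the restriction of [phi] to the subalgebra H is meaningful. *)
Definition isometrically_isomorphic (X Y : topologicalType)
    (H : set (CB X R)) (K : set (CB Y R)) :=
  exists phi : CB X R -> CB Y R,
  [/\ set_bij H K phi,
      forall f g, H f -> H g -> phi (f + g) = phi f + phi g,
      forall a f, H f -> phi (a *: f) = a *: phi f,
      forall f g, H f -> H g -> phi (f * g) = phi f * phi g
    & forall f, H f -> `|phi f| = `|f|].

(* The characters of the algebra H, which need not be unital: the operations of
   H are those of [CB X R], whence the formulation through [set_val]. *)
Definition character (X : topologicalType) (H : set (CB X R))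
    (chi : {ptws H -> C}) :=
  [/\ exists h, chi h != 0,
      forall f g h : H,
        set_val h = set_val f + set_val g -> chi h = chi f + chi g,
      forall (a : C) (f h : H), set_val h = a *: set_val f -> chi h = a * chi f
    & forall f g h : H,
        set_val h = set_val f * set_val g -> chi h = chi f * chi g].

(* The topology is that of pointwise convergence on H (the weak-* topology). *)
Definition spectrum (X : topologicalType) (H : set (CB X R))
  : topologicalType := set_type (@character X H).

End FunctionAlgebras.

Arguments C0 R Y : clear implicits.

(* Main.v *)
(* Y is open in the compactification, so it is locally compact, and it contains
   X densely because points of X are separated from closed sets by null
   functions.  A function f in the null algebra extends to beta X with every
   level set [r <= |f|] inside Y, so its restriction to Y vanishes at infinity;
   conversely a compact subset of Y meets X in a null set, since it is covered
   by finitely many of the open sets defining Y.  Extension and restriction are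
   thus inverse isometric isomorphisms.  For any locally compact Z, every
   character of C_0(Z) is an evaluation, by a purely algebraic argument that
   uses no continuity of the character; this identifies Z with the spectrum of
   any algebra isomorphic to C_0(Z), which gives both the uniqueness of Y and
   its description as a spectrum. *)
Require Import Defs.
From mathcomp Require Import all_boot all_order all_algebra.
From mathcomp Require Import all_classical all_reals all_analysis.
From mathcomp Require Import complex.
From mathcomp Require Import ring lra.

Import Order.TTheory GRing.Theory Num.Theory.
Import numFieldNormedType.Exports.

Local Open Scope classical_set_scope.
Local Open Scope ring_scope.

Set Implicit Arguments.
Unset Strict Implicit.
Unset Printing Implicit Defensive.

(** * Real-valued modulus and continuity of maps to and from [C] *)

Section ComplexNumbers.
Variable R : realType.
Local Notation C := (Cplx R).

Definition cplx_of (r : R) : C := r%:C%C.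
(** The norm on [C] is itself [C]-valued; a modulus in [R] gives access to a total order and to
    linear arithmetic. *)
Definition cmod (z : C) : R := complex.Re `|z|.

Lemma normCE (z : C) : `|z| = cplx_of (cmod z).
Proof. by rewrite /cplx_of normCR. Qed.

Lemma le_cplx_of (r s : R) : (cplx_of r <= cplx_of s) = (r <= s).
Proof. by rewrite lecR. Qed.

Lemma lt_cplx_of (r s : R) : (cplx_of r < cplx_of s) = (r < s).
Proof. by rewrite ltcR. Qed.

Lemma norm_cplx_of (r : R) : `|cplx_of r| = cplx_of `|r|.
Proof. by rewrite /cplx_of normc_def /= expr0n/= addr0 sqrtr_sqr. Qed.

Lemma cplx_ofD (r s : R) : cplx_of (r + s) = cplx_of r + cplx_of s.
Proof. exact: rmorphD. Qed.

Lemma cplx_ofB (r s : R) : cplx_of (r - s) = cplx_of r - cplx_of s.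
Proof. exact: rmorphB. Qed.

Lemma cplx_ofM (r s : R) : cplx_of (r * s) = cplx_of r * cplx_of s.
Proof. exact: rmorphM. Qed.

Lemma cplx_of_gt0E (e : C) : 0 < e -> e = cplx_of (complex.Re e).
Proof. by move=> e0; rewrite /cplx_of RRe_real// ger0_real// ltW. Qed.

Lemma cplx_of_invn (n : nat) : n%:R^-1 = cplx_of n%:R^-1 :> C.
Proof. by rewrite /cplx_of fmorphV/= rmorph_nat. Qed.

Lemma cmod_ge0 (z : C) : 0 <= cmod z.
Proof. by rewrite -le_cplx_of -normCE normr_ge0. Qed.

Lemma cmod_eq0 (z : C) : (cmod z == 0) = (z == 0).
Proof.
rewrite -(normr_eq0 z) normCE; apply/eqP/eqP => [->//|].
by move=> /(congr1 (@complex.Re R)).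
Qed.

Lemma cmod_gt0 (z : C) : (0 < cmod z) = (z != 0).
Proof. by rewrite lt_neqAle eq_sym cmod_eq0 cmod_ge0 andbT. Qed.

Lemma cmodM (z w : C) : cmod (z * w) = cmod z * cmod w.
Proof.
by apply/eqP; rewrite eq_le -!le_cplx_of cplx_ofM -!normCE normrM lexx.
Qed.

Lemma ler_cmodD (z w : C) : cmod (z + w) <= cmod z + cmod w.
Proof. by rewrite -le_cplx_of cplx_ofD -!normCE ler_normD. Qed.

Lemma cmod_cplx_of (r : R) : cmod (cplx_of r) = `|r|.
Proof. by rewrite /cmod norm_cplx_of. Qed.

Lemma cmod0 : cmod (0 : C) = 0.
Proof. by apply/eqP; rewrite cmod_eq0. Qed.

Lemma cmod1 : cmod (1 : C) = 1.
Proof. by have := cmod_cplx_of 1; rewrite normr1. Qed.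

Lemma cplx_of_eq0 (r : R) : (cplx_of r == 0) = (r == 0).
Proof. by rewrite -cmod_eq0 cmod_cplx_of normr_eq0. Qed.

Lemma ler_Re_cmod (z : C) : `|complex.Re z| <= cmod z.
Proof. by rewrite -le_cplx_of -normCE; exact: normc_ge_Re. Qed.

Lemma ler_Im_cmod (z : C) : `|complex.Im z| <= cmod z.
Proof.
by rewrite -le_cplx_of -normCE normc_def lecR -sqrtr_sqr ler_wsqrtr// lerDr sqr_ge0.
Qed.

Lemma cplx_of_continuous : continuous cplx_of.
Proof.
move=> r; apply/cvgrPdist_lt => e e0.
have re0 : 0 < complex.Re e by rewrite -lt_cplx_of -cplx_of_gt0E.
have /cvgrPdist_lt/(_ _ re0) := @cvg_id _ (nbhs r); apply: filterS => t.
by rewrite -cplx_ofB norm_cplx_of (cplx_of_gt0E e0) lt_cplx_of.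
Qed.

Lemma continuous_cplx_real (f : C -> R) :
  (forall z w, cplx_of `|f z - f w| <= `|z - w|) -> continuous f.
Proof.
move=> f1 z; apply/(@cvgrPdist_lt _ R _ (nbhs z)) => e e0.
have /cvgrPdist_lt/(_ (cplx_of e)) := @cvg_id _ (nbhs z).
rewrite lt_cplx_of => /(_ e0); apply: filterS => t.
by rewrite -(lt_cplx_of _ e); exact: le_lt_trans.
Qed.

Lemma Re_continuous : continuous (@complex.Re R : C -> R).
Proof.
apply: continuous_cplx_real => z w.
by rewrite -raddfB normCE le_cplx_of ler_Re_cmod.
Qed.

Lemma Im_continuous : continuous (@complex.Im R : C -> R).
Proof.
apply: continuous_cplx_real => z w.
by rewrite -raddfB normCE le_cplx_of ler_Im_cmod.
Qed.

Lemma cmod_continuous : continuous cmod.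
Proof.
apply: continuous_cplx_real => z w.
by rewrite -norm_cplx_of cplx_ofB -!normCE; exact: ler_dist_dist.
Qed.

Lemma conjC_continuous : continuous (Num.conj : C -> C).
Proof.
move=> z; apply/(@cvgrPdist_lt _ C _ (nbhs z)) => e e0.
have /cvgrPdist_lt/(_ _ e0) := @cvg_id _ (nbhs z).
by apply: filterS => t; rewrite -raddfB norm_conjC.
Qed.

End ComplexNumbers.

(** * The null algebra is a closed ideal *)

Section NullIdeals.
Variables (R : realType) (X : topologicalType).
Local Notation C := (Cplx R).

Lemma bounded_continuous_cmod (f : X -> C) (M : R) :
  continuous f -> (forall x, cmod (f x) <= M) -> f \in @bounded_continuous X R.
Proof.
move=> cf fM; apply/bounded_continuousP; split=> //; exists (cplx_of `|M|).
  by rewrite -[0]/(cplx_of (0 : R)) le_cplx_of normr_ge0.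
by move=> x; rewrite normCE le_cplx_of (le_trans (fM x))// ler_norm.
Qed.

Definition CB_of (f : X -> C) (M : R) (cf : continuous f)
  (fM : forall x, cmod (f x) <= M) : CB X R := MkCB (bounded_continuous_cmod cf fM).

Lemma CB_continuous (f : CB X R) : continuous f.
Proof. by have [] := CBP f. Qed.

Lemma CB_cmod_continuous (f : CB X R) : continuous (fun x => cmod (f x)).
Proof.
move=> x; apply: (@continuous_comp _ _ _ f (@cmod R)); first exact: CB_continuous.
exact: cmod_continuous.
Qed.

Lemma CB_cmod_bounded (f : CB X R) : exists2 M : R, 0 <= M & forall x, cmod (f x) <= M.
Proof.
exists (cmod `|f|); first exact: cmod_ge0.
by move=> x; rewrite -le_cplx_of -!normCE normr_id; exact: CBnorm_ub.
Qed.

Lemma CBext (f g : CB X R) : (forall x, f x = g x) -> f = g.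
Proof. by move=> fg; apply: val_inj; apply/funext. Qed.

Lemma CB_addE (f g : CB X R) x : (f + g) x = f x + g x. Proof. by []. Qed.
Lemma CB_subE (f g : CB X R) x : (f - g) x = f x - g x. Proof. by []. Qed.
Lemma CB_mulE (f g : CB X R) x : (f * g) x = f x * g x. Proof. by []. Qed.
Lemma CB_scaleE (a : C) (f : CB X R) x : (a *: f) x = a * f x. Proof. by []. Qed.
Lemma CB_oneE x : (1 : CB X R) x = 1. Proof. by []. Qed.
Definition CBE := (CB_subE, CB_addE, CB_mulE, CB_scaleE, CB_oneE).

Lemma open_cmod_gt (f : CB X R) (e : R) : open [set x | e < cmod (f x)].
Proof.
by apply: (@open_comp _ _ (fun x => cmod (f x)) [set r | e < r]) => [x _|];
  [exact: CB_cmod_continuous | exact: open_gt].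
Qed.

Lemma closed_cmod_ge (f : CB X R) (e : R) : closed [set x | e <= cmod (f x)].
Proof.
apply: (@closed_comp _ _ (fun x => cmod (f x)) [set r | e <= r]) => [x _|].
  exact: CB_cmod_continuous.
exact: closed_ge.
Qed.

Variables (I : set_system X) (idealI : set_ideal I).

Lemma ideal_subset A B : A `<=` B -> I B -> I A.
Proof. by move: idealI => [_ + _]; exact. Qed.

(** The numbers 1/n get below every positive real and level sets shrink as the threshold grows. Real
    thresholds can then be halved and rescaled freely. *)
Lemma C0_nullP (f : CB X R) :
  C0_null R I f <-> forall e : R, 0 < e -> I [set x | e <= cmod (f x)].
Proof.
split=> [If e e0|If n n0].
  have [n n0 ne] : exists2 n : nat, (0 < n)%N & n%:R^-1 <= e.
    exists (Num.truncn e^-1).+1 => //; rewrite invf_ple ?posrE ?ltr0n//.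
    exact/ltW/truncnS_gt.
  apply: ideal_subset (If n n0) => x /= ex.
  by rewrite cplx_of_invn normCE le_cplx_of (le_trans ne).
have /If : 0 < n%:R^-1 :> R by rewrite invr_gt0 ltr0n.
by apply: ideal_subset => x /=; rewrite cplx_of_invn normCE le_cplx_of.
Qed.

Lemma C0_null_ideal : algebra_ideal (C0_null R I).
Proof.
have [[N IN] _ IU] := idealI.
(* With [M] bounding |g|, |g f| >= e forces |f| >= e / (M + 1); the added 1 keeps the divisor
   positive when [M] is 0. *)
have mulI (f g : CB X R) : C0_null R I f -> C0_null R I (g * f).
  move=> /C0_nullP If; apply/C0_nullP => e e0.
  have [M M0 gM] := CB_cmod_bounded g.
  have M1 : 0 < M + 1 by rewrite ltr_wpDl.
  have /If : 0 < e / (M + 1) by rewrite divr_gt0.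
  apply: ideal_subset => x /= egf; rewrite ler_pdivrMr//; apply: le_trans egf _.
  by rewrite cmodM mulrC ler_wpM2l ?cmod_ge0// (le_trans (gM x))// lerDl.
split => //.
- apply/C0_nullP => e e0; apply: ideal_subset IN => x /=.
  by rewrite cmod0 leNgt e0.
- move=> f g /C0_nullP If /C0_nullP Ig; apply/C0_nullP => e e0.
  have e20 : 0 < e / 2 by rewrite divr_gt0.
  apply: ideal_subset (IU _ _ (If _ e20) (Ig _ e20)) => x /= efg.
  have [|fe] := leP (e / 2) (cmod (f x)); first by left.
  right => /=; have := le_trans efg (ler_cmodD (f x) (g x)); lra.
- move=> a f If; suff -> : a *: f = (a *: (1 : CB X R)) * f by exact: mulI.
  by apply: CBext => x; rewrite -[RHS]/(a * 1 * f x) mulr1.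
Qed.

(** If |f - g| < e / 2 everywhere, then |f| >= e forces |g| >= e / 2, so a level set of the limit
    lies in one of a nearby null function. *)
Lemma C0_null_closed : closed (C0_null R I).
Proof.
move=> f clf; apply/C0_nullP => e e0.
have ce0 : 0 < cplx_of (e / 2) by rewrite -[0]/(cplx_of (0 : R)) lt_cplx_of divr_gt0.
have [g [/C0_nullP Ig fg]] := clf _ (nbhsx_ballx f _ ce0).
have /Ig : 0 < e / 2 by rewrite divr_gt0.
apply: ideal_subset => x /= efx.
have : cmod (f x - g x) < e / 2.
  rewrite -lt_cplx_of -normCE; apply: le_lt_trans fg; exact: (CBnorm_ub (f - g)).
have := ler_cmodD (f x - g x) (g x); rewrite subrK; lra.
Qed.

End NullIdeals.

(** * Ideals of sets and compactness *)

Section CompactIdeals.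

(* Otherwise the sets whose complement in K lies in the ideal form a proper
   filter, and a cluster point of it in K has no neighborhood in the ideal. *)
Lemma compact_locally_in_ideal (T : topologicalType) (P : set_system T) (K : set T) :
  set_ideal P -> compact K -> (forall x, K x -> exists2 N, nbhs x N & P N) -> P K.
Proof.
move=> [[N0 PN0] PS PU] cK locP; apply: contrapT => nPK.
pose F : set_system T := [set A | P (K `\` A)].
have FF : ProperFilter F.
  split; first by rewrite /F /= setD0.
  split.
  - by rewrite /F /= setDT; exact: PS PN0.
  - by move=> A B FA FB; rewrite /F /= setDIr; exact: PU.
  - by move=> A B AB; apply: PS; exact: setDS.
have [|p [Kp clp]] := cK F FF; first by rewrite /F /= setDv; exact: PS PN0.
have [N nN PN] := locP p Kp.
have [|x [nNx Nx]//] := clp (~` N) N _ nN.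
by apply: PS PN; rewrite setDE setCK; exact: subIsetr.
Qed.

Lemma precompact_ideal (T : topologicalType) : set_ideal (@precompact T).
Proof.
split.
- by exists set0; rewrite precompactE closure0; exact: compact0.
- exact: precompact_subset.
- by move=> A B; rewrite !precompactE closureU; exact: compactU.
Qed.

(** Level sets are closed, so for them compact and precompact agree. Facts about null algebras
    thereby apply to [C0 R Z]. *)
Lemma C0_nullE (R : realType) (Z : topologicalType) : C0 R Z = C0_null R (@precompact Z).
Proof.
apply/seteqP; split=> f Kf n n0; have := Kf n n0;
  rewrite precompact_closed// (_ : [set _ | _] = [set x | n%:R^-1 <= cmod (f x)]);
  try (by apply: closed_cmod_ge);
  by apply/seteqP; split=> x /=; rewrite cplx_of_invn normCE le_cplx_of.
Qed.

End CompactIdeals.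

(** * Null functions separate points from closed sets *)

Section Separation.
Variables (R : realType) (X : topologicalType) (I : set_system X).
Hypotheses (idealI : set_ideal I) (cregX : completely_regular_space X).

(** Complete regularity gives [f] into [0, 1], equal to 0 at [x] and to 1 off the interior of [U].
    The function 1 - f vanishes off the null set [U], hence all its level sets are null. *)
Lemma C0_null_separates (x : X) (U : set X) : nbhs x U -> I U ->
  exists g : CB X R, [/\ C0_null R I g, g x = 1 & forall y, g y != 0 -> U y].
Proof.
move=> nU IU.
have cU : closed (~` interior U) by apply: open_closedC; exact: open_interior.
have /(@uniform_separatorP _ R)[f [cf f01 fx fU]] := cregX cU (fun k => k nU).
have f0 y : 0 <= 1 - f y by have /= := f01 _ (imageT f y); rewrite in_itv/=; lra.
have f1 y : 1 - f y <= 1 by have /= := f01 _ (imageT f y); rewrite in_itv/=; lra.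
have cg : continuous (fun y => cplx_of (1 - f y)).
  move=> y; apply: (@continuous_comp _ _ _ (fun y => 1 - f y) (@cplx_of R)).
    by apply: cvgB; [exact: cvg_cst | exact: cf].
  exact: cplx_of_continuous.
have gU y : cplx_of (1 - f y) != 0 -> U y.
  apply: contraNP => nUy; suff -> : f y = 1 by rewrite subrr.
  by apply: fU; exists y => // /interior_subset.
have cg1 y : cmod (cplx_of (1 - f y)) <= 1 by rewrite cmod_cplx_of ger0_norm.
exists (CB_of cg cg1).
split=> //.
- apply/C0_nullP => // e e0; apply: ideal_subset IU => // y /= ey; apply: gU.
  by rewrite -cmod_gt0 (lt_le_trans e0).
- by rewrite /= (_ : f x = 0) ?subr0//; apply: fx; exists x.
Qed.

End Separation.

(** * Characters of [C0 R Z] are evaluations *)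

Section Characters.
Variables (R : realType) (Z : topologicalType).
Local Notation C := (Cplx R).
Hypotheses (hausZ : hausdorff_space Z) (lcZ : locally_compact [set: Z]).

Lemma C0_ideal : algebra_ideal (C0 R Z).
Proof. rewrite C0_nullE; exact/C0_null_ideal/precompact_ideal. Qed.

Lemma C0_separates (z : Z) (U : set Z) : nbhs z U ->
  exists g : CB Z R, [/\ C0 R Z g, g z = 1 & forall y, g y != 0 -> U y].
Proof.
move=> nU; have [V nV [KV cV]] := lcZ (I : [set: Z] z).
rewrite C0_nullE.
have nUV : nbhs z (U `&` V).
  by apply: filterI nU _; move: nV; rewrite /within /=; apply: filterS => y; exact.
have [|g [Kg gz gU]] := C0_null_separates R (@precompact_ideal Z)
    (locally_compact_completely_regular (R := R) lcZ hausZ) nUV.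
- by exists V => // y [].
by exists g; split=> // y /gU[].
Qed.

(** Sets on which |f| has a positive lower bound form an ideal, and continuity puts a neighborhood
    of each point of [K] in it. *)
Lemma cmod_bounded_below_compact (K : set Z) (f : CB Z R) :
  compact K -> (forall z, K z -> f z != 0) ->
  exists2 c : R, 0 < c & forall z, K z -> c <= cmod (f z).
Proof.
move=> cK fK.
pose P := [set A : set Z | exists2 c : R, 0 < c & forall z, A z -> c <= cmod (f z)].
apply: (@compact_locally_in_ideal _ P) => //.
  split; first by exists set0, 1.
  - by move=> A B AB [c c0 cB]; exists c => // z /AB /cB.
  - move=> A B [c c0 cA] [d d0 dB]; exists (Num.min c d); first by rewrite lt_min c0.
    by move=> z [/cA|/dB]; rewrite ge_min => ->; rewrite ?orbT.
move=> z Kz; have fz : 0 < cmod (f z) / 2 by rewrite divr_gt0// cmod_gt0 fK.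
exists [set y | cmod (f z) / 2 < cmod (f y)].
  by apply: open_nbhs_nbhs; split; [exact: open_cmod_gt | rewrite /=; lra].
by exists (cmod (f z) / 2) => // y /ltW.
Qed.

Lemma cmod_conj (z : C) : cmod z^* = cmod z.
Proof. by rewrite /cmod norm_conjC. Qed.

Lemma CB_conj_continuous (f : CB Z R) : continuous (fun z => (f z)^*).
Proof.
move=> z; apply: (@continuous_comp _ _ _ f (Num.conj : C -> C)).
  exact: CB_continuous.
exact: conjC_continuous.
Qed.

Lemma CB_conj_exists (f : CB Z R) :
  exists2 g : CB Z R, forall z, g z = (f z)^* & C0 R Z f -> C0 R Z g.
Proof.
have [M _ fM] := CB_cmod_bounded f.
have cM z : cmod (f z)^* <= M by rewrite cmod_conj.
exists (CB_of (@CB_conj_continuous f) cM) => //.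
by rewrite C0_nullE => Kf n /Kf; congr precompact; apply/seteqP; split=> z /=;
  rewrite norm_conjC.
Qed.

Lemma CB_inv_exists (f : CB Z R) (c : R) : 0 < c -> (forall z, c <= cmod (f z)) ->
  exists g : CB Z R, forall z, g z = (f z)^-1.
Proof.
move=> c0 cf.
have f0 z : f z != 0 by rewrite -cmod_gt0 (lt_le_trans c0).
have cg : continuous (fun z => (f z)^-1).
  by move=> z; apply: cvgV => //; exact: CB_continuous.
have gc z : cmod (f z)^-1 <= c^-1.
  have : cmod (f z)^-1 * cmod (f z) = 1.
    by rewrite -cmodM mulVf// cmod1.
  move/(canRL (mulfK _)) => -> ; last by rewrite cmod_eq0.
  by rewrite mul1r lef_pV2 ?posrE// cmod_gt0.
by exists (CB_of cg gc).
Qed.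

Variable chi : CB Z R -> C.
Hypotheses (chi0 : exists2 h, C0 R Z h & chi h != 0)
  (chiD : forall f g, C0 R Z f -> C0 R Z g -> chi (f + g) = chi f + chi g)
  (chiZ : forall a f, C0 R Z f -> chi (a *: f) = a * chi f)
  (chiM : forall f g, C0 R Z f -> C0 R Z g -> chi (f * g) = chi f * chi g).

(** If [f] is in the kernel of [chi], so is its product with its conjugate, which is |f|^2.
    Nonnegative functions cannot cancel in a sum, so the sets on which some nonnegative kernel
    element has no zero form an ideal, and compactness applies. *)
Let kernel_sum_positive (K : set Z) : compact K ->
  (forall z, exists f, [/\ C0 R Z f, chi f = 0 & f z != 0]) ->
  exists F : CB Z R, [/\ C0 R Z F, chi F = 0,
    forall z, 0 <= F z & forall z, K z -> F z != 0].
Proof.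
have [K0 KD KZ KM] := C0_ideal.
move=> cK ker.
pose P := [set A : set Z | exists F : CB Z R, [/\ C0 R Z F, chi F = 0,
    forall z, 0 <= F z & forall z, A z -> F z != 0]].
apply: (@compact_locally_in_ideal _ P) => //.
  split.
  - exists set0, 0; split => //.
    by have := chiZ 0 K0; rewrite scale0r mul0r.
  - by move=> A B AB [F [KF cF F0 FB]]; exists F; split=> // z /AB /FB.
  - move=> A B [F [KF cF F0 FA]] [G [KG cG G0 GB]]; exists (F + G); split.
    + exact: KD.
    + by rewrite chiD// cF cG addr0.
    + by move=> z; rewrite CB_addE addr_ge0.
    + move=> z AB; rewrite CB_addE paddr_eq0//.
      by apply/nandP; case: AB => [/FA|/GB]; [left | right].
move=> z Kz; have [f [Kf cf fz]] := ker z.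
have [g gf /(_ Kf) Kg] := CB_conj_exists f.
exists [set y | 0 < cmod (f y)].
  by apply: open_nbhs_nbhs; split; [exact: open_cmod_gt | rewrite /= cmod_gt0].
have gfE y : (g * f) y = `|f y| ^+ 2 by rewrite normCKC -gf.
exists (g * f); split.
- exact: KM.
- by rewrite chiM// cf mulr0.
- by move=> y; rewrite gfE exprn_ge0.
- by move=> y fy; rewrite gfE expf_eq0/= normr_eq0 -cmod_gt0.
Qed.

(* If every point is outside the zero set of some kernel element, a sum F of
   squares of moduli of kernel elements is positive on [|h| >= 1/2], where
   chi h = 1.  For q = 1 - |1 - h|^2 - F we get chi q = 1 with 1 - q bounded
   away from 0, and chi(r) = chi(q) + chi(r) chi(q) for r = q / (1 - q) is
   absurd. *)
Lemma C0_character_eval : exists z, forall f, C0 R Z f -> chi f = f z.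
Proof.
have [K0 KD KZ KM] := C0_ideal.
have [h Kh ch] : exists2 h, C0 R Z h & chi h = 1.
  have [h Kh ch] := chi0; exists ((chi h)^-1 *: h); first exact: KZ.
  by rewrite chiZ// mulVf.
(* A common zero [z] of the kernel suffices: f - chi(f) h is in the kernel, so f(z) = chi(f) h(z).
   Taking f = h * h gives h(z)^2 = h(z), and h(z) is nonzero because some function of the algebra is
   1 at [z]. *)
suff [z zker] : exists z, forall f, C0 R Z f -> chi f = 0 -> f z = 0.
  have fz f : C0 R Z f -> f z = chi f * h z.
    move=> Kf; apply/eqP; rewrite -subr_eq0; apply/eqP.
    have Kh' : C0 R Z (- chi f *: h) := KZ _ _ Kh.
    rewrite -mulNr; apply: (zker _ (KD _ _ Kf Kh')).
    by rewrite (chiD Kf Kh') (chiZ _ Kh) ch mulr1 subrr.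
  have [g [Kg gz _]] := C0_separates (@filterT _ (nbhs z) _).
  have hz0 : h z != 0.
    by apply/eqP => hz; have := fz g Kg; rewrite gz hz mulr0 => /eqP; rewrite oner_eq0.
  have hz : h z = 1.
    apply: (mulfI hz0); rewrite mulr1; have := fz (h * h) (KM _ _ Kh).
    by rewrite (chiM Kh Kh) ch mulr1 mul1r.
  by exists z => f Kf; rewrite fz// hz mulr1.
apply: contrapT => noz.
have ker z : exists f, [/\ C0 R Z f, chi f = 0 & f z != 0].
  apply: contrapT => nof; apply: noz; exists z => f Kf cf.
  by apply/eqP; apply: contrapT => /negP fz; apply: nof; exists f.
have cK : compact [set z | 2^-1 <= cmod (h z)].
  rewrite -precompact_closed; last exact: closed_cmod_ge.
  have := Kh; rewrite C0_nullE => /(C0_nullP (@precompact_ideal Z)); apply.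
  by rewrite invr_gt0.
have [F [KF cF F0 FK]] := kernel_sum_positive cK ker.
have [c c0 cFK] := cmod_bounded_below_compact cK FK.
have [hb hbE /(_ Kh) Khb] := CB_conj_exists h.
(* The constant 1 need not lie in the algebra, so 1 - |1 - h|^2 - F is expanded into members of it
   before [chi] is applied. In [chi q] the unknown value [chi hb] cancels. *)
pose q : CB Z R := h + (hb + ((-1) *: (hb * h) + (-1) *: F)).
have Khbh : C0 R Z (hb * h) := KM _ _ Kh.
have Kr1 : C0 R Z ((-1) *: (hb * h)) := KZ _ _ Khbh.
have Kr2 : C0 R Z ((-1) *: F) := KZ _ _ KF.
have Kr := KD _ _ Kr1 Kr2.
have Kr3 := KD _ _ Khb Kr.
have Kq : C0 R Z q := KD _ _ Kh Kr3.
have cq : chi q = 1.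
  rewrite /q (chiD Kh Kr3) (chiD Khb Kr) (chiD Kr1 Kr2) (chiZ _ Khbh) (chiZ _ KF).
  by rewrite (chiM Khb Kh) cF ch; ring.
have qE z : (1 - q) z = cplx_of (cmod (1 - h z) ^+ 2 + cmod (F z)).
  rewrite cplx_ofD -(normCE (F z)) ger0_norm// expr2 cplx_ofM -!normCE -expr2.
  rewrite normCKC (_ : (1 - h z)^* = 1 - hb z); last by rewrite rmorphB rmorph1 hbE.
  by rewrite /q !CBE; ring.
have q_below z : Num.min c 4^-1 <= cmod ((1 - q) z).
  rewrite qE cmod_cplx_of ger0_norm ?addr_ge0 ?cmod_ge0 ?sqr_ge0// ge_min.
  have [/cFK|h2] := leP 2^-1 (cmod (h z)).
    by move=> cFz; rewrite (le_trans cFz) ?lerDr ?sqr_ge0.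
  (* Here |h| < 1/2, so |1 - h| > 1/2, whose square exceeds 1/4. *)
  have := ler_cmodD (1 - h z) (h z); rewrite subrK.
  rewrite cmod1 => h1.
  have F1 := cmod_ge0 (F z).
  apply/orP; right; nra.
have m0 : 0 < Num.min c 4^-1 by rewrite lt_min c0 invr_gt0 ltr0n.
have [v vE] := CB_inv_exists m0 q_below.
have q0 z : (1 - q) z != 0 by rewrite -cmod_gt0 (lt_le_trans m0 (q_below z)).
(* The inverse [v] of 1 - q need not vanish at infinity; multiplying by [q] returns to the ideal,
   where [chi] is multiplicative. *)
have Kvq : C0 R Z (v * q) := KM _ _ Kq.
have Kvqq : C0 R Z (v * q * q) := KM _ _ Kq.
have : v * q = q + (v * q) * q.
  apply: CBext => z; rewrite CB_addE; apply/eqP; rewrite -subr_eq; apply/eqP.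
  rewrite (_ : _ - _ = v z * (1 - q) z * q z); last by rewrite !CBE; ring.
  by rewrite vE mulVf// mul1r.
move=> /(congr1 chi); rewrite (chiD Kq Kvqq) (chiM Kvq Kq) cq mulr1 => /eqP.
by rewrite -subr_eq subrr eq_sym oner_eq0.
Qed.

End Characters.

(** * Homeomorphisms and continuity into subspaces and powers *)

Section Homeomorphisms.

Lemma homeomorphic_sym (S T : topologicalType) : homeomorphic S T -> homeomorphic T S.
Proof. by move=> [f [g [cf cg fK gK]]]; exists g, f. Qed.

Lemma homeomorphic_trans (S T U : topologicalType) :
  homeomorphic S T -> homeomorphic T U -> homeomorphic S U.
Proof.
move=> [f [g [cf cg fK gK]]] [f' [g' [cf' cg' fK' gK']]].
exists (f' \o f), (g \o g'); split.
- by move=> x; apply: continuous_comp; [exact: cf | exact: cf'].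
- by move=> x; apply: continuous_comp; [exact: cg' | exact: cg].
- exact: can_comp.
- exact: can_comp.
Qed.

Lemma continuous_to_set_type (S T : topologicalType) (A : set T) (f : S -> A) :
  continuous (fun x => set_val (f x)) -> continuous f.
Proof.
move=> cf x U [_ [[V oV <-] /= Vfx] VU].
by apply: filterS VU _; apply: cf; exact: open_nbhs_nbhs.
Qed.

Lemma continuous_to_ptws (S T : topologicalType) (A : choiceType) (f : S -> {ptws A -> T}) :
  (forall a, continuous (fun x => f x a)) -> continuous f.
Proof.
move=> cf x; apply/cvg_sup => a U [_ [[V oV <-] /= Vfx] VU].
by apply: filterS VU _; apply: cf; exact: open_nbhs_nbhs.
Qed.

End Homeomorphisms.

(** * Recovering a locally compact space as a spectrum *)

Section Spectrum.
Variables (R : realType) (X Z : topologicalType) (H : set (CB X R)).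
Local Notation C := (Cplx R).
Hypotheses (idealH : algebra_ideal H) (hausZ : hausdorff_space Z)
  (lcZ : locally_compact [set: Z]).

(** A point [z] is sent to the character h |-> phi(h)(z). Separation by [C0 R Z] makes this map
    injective with continuous inverse; surjectivity is the description of characters as
    evaluations. *)
Lemma spectrum_homeomorphic :
  isometrically_isomorphic H (C0 R Z) -> homeomorphic Z (spectrum H).
Proof.
have [H0 HD HZ HM] := idealH.
move=> [phi [[phiH phi_inj phi_surj] phiD phiZ phiM _]].
have lift g : C0 R Z g -> exists h : H, phi (set_val h) = g.
  by move=> Kg; have [h Hh <-] := phi_surj g Kg; exists (SigSub (mem_set Hh)).
have HP (h : H) : H (set_val h) by exact: (@set_valP _ H h).
pose ev (z : Z) : {ptws H -> C} := fun h => phi (set_val h) z.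
have ev_char z : character (ev z).
  split.
  - have [g [Kg gz _]] := C0_separates R hausZ lcZ (@filterT _ (nbhs z) _).
    by have [h hg] := lift g Kg; exists h; rewrite /ev hg gz oner_eq0.
  - by move=> f g h e; rewrite /ev e phiD.
  - by move=> a f h e; rewrite /ev e phiZ.
  - by move=> f g h e; rewrite /ev e phiM.
pose E z : spectrum H := SigSub (mem_set (ev_char z)).
have EE z h : set_val (E z) h = phi (set_val h) z by [].
have cE : continuous E.
  apply: continuous_to_set_type; apply: continuous_to_ptws => h z.
  exact: (@CB_continuous _ _ (phi (set_val h))).
have Esep z (U : set Z) : nbhs z U -> exists h : H, set_val (E z) h != 0 /\
    forall w, set_val (E w) h != 0 -> U w.
  move=> nU; have [g [Kg gz gU]] := C0_separates R hausZ lcZ nU.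
  have [h hg] := lift g Kg; exists h; split; first by rewrite EE hg gz oner_eq0.
  by move=> w; rewrite EE hg; exact: gU.
have Einj : injective E.
  move=> z w Ezw; apply: contrapT => zw.
  have : nbhs z (~` [set w]).
    apply: open_nbhs_nbhs; split => //; apply: closed_openC.
    exact: accessible_closed_set1 (hausdorff_accessible hausZ) _.
  by move=> /Esep[h []]; rewrite Ezw => hw /(_ w hw); exact.
have Esurj (chi : spectrum H) : exists z, E z = chi.
  have [[h0 h0n] chiD chiZ chiM] := set_valP chi.
  have inv g : C0 R Z g -> {h : H | phi (set_val h) = g}.
    by move=> Kg; exact/cid/lift.
  pose chi' (g : CB Z R) : C :=
    if pselect (C0 R Z g) is left Kg then set_val chi (sval (inv g Kg)) else 0.
  have chi'E (h : H) : chi' (phi (set_val h)) = set_val chi h.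
    rewrite /chi'; case: pselect => [Kg|]; last by move=> /(_ (phiH _ (HP h))).
    case: (inv _ _) => k /= hk; congr (set_val chi _); apply: val_inj.
    by apply: phi_inj; rewrite ?inE//; exact: HP.
  have chi'_val f (Hf : H f) : chi' (phi f) = set_val chi (SigSub (mem_set Hf)).
    by rewrite -chi'E.
  have chi'0 : exists2 g, C0 R Z g & chi' g != 0.
    by exists (phi (set_val h0)); [exact/phiH | rewrite chi'E].
  have chi'D f g : C0 R Z f -> C0 R Z g -> chi' (f + g) = chi' f + chi' g.
    move=> /lift[h <-] /lift[k <-].
    by rewrite -phiD// (chi'_val _ (HD _ _ (HP h) (HP k))) !chi'E; exact: chiD.
  have chi'Z a f : C0 R Z f -> chi' (a *: f) = a * chi' f.
    move=> /lift[h <-].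
    by rewrite -phiZ// (chi'_val _ (HZ a _ (HP h))) chi'E; exact: chiZ.
  have chi'M f g : C0 R Z f -> C0 R Z g -> chi' (f * g) = chi' f * chi' g.
    move=> /lift[h <-] /lift[k <-].
    by rewrite -phiM// (chi'_val _ (HM _ _ (HP k))) !chi'E; exact: chiM.
  have [z zE] := C0_character_eval hausZ lcZ chi'0 chi'D chi'Z chi'M.
  exists z; apply: val_inj; apply/funext => h /=.
  by rewrite /ev -zE ?chi'E//; exact/phiH.
pose G (chi : spectrum H) : Z := sval (cid (Esurj chi)).
have GK : cancel G E by move=> chi; rewrite /G; case: cid.
have EK : cancel E G by move=> z; apply: Einj; exact: GK.
exists E, G; split => //.
(* Continuity of [G]: the characters not vanishing at the separating [h] form an open set around
   [chi], and [G] maps it into [U]. *)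
move=> chi U /Esep[h []]; rewrite GK => hn hU.
have ch : continuous (fun psi : spectrum H => set_val psi h).
  move=> psi; apply: (@continuous_comp _ _ _ set_val (fun k : {ptws H -> C} => k h)).
    exact: initial_continuous.
  exact: proj_continuous.
suff : nbhs chi [set psi | 0 < cmod (set_val psi h)].
  by apply: filterS => psi; rewrite /= cmod_gt0 -{1}(GK psi) => /hU.
apply: open_nbhs_nbhs; split; last by rewrite /= cmod_gt0.
have cc : continuous (fun psi : spectrum H => cmod (set_val psi h)).
  by move=> psi; apply: continuous_comp (ch psi) _; exact: cmod_continuous.
apply: (open_comp _ (@open_gt _ 0)) => psi _; exact: cc.
Qed.

End Spectrum.

(** * Functions determined on a dense image *)

Section DenseMaps.
Variables (R : realType) (X Y : topologicalType).
Local Notation C := (Cplx R).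

Lemma dense_closed_setT (D A : set Y) : dense D -> closed A -> D `<=` A -> forall y, A y.
Proof.
move=> dD cA DA y; apply: contrapT => nAy.
have [|z [nAz /DA//]] := dD (~` A) _ (closed_openC cA).
by exists y.
Qed.

Variables (j : X -> Y).

Lemma CB_pullback (cj : continuous j) (f : CB Y R) :
  exists g : CB X R, forall x, g x = f (j x).
Proof.
have [M _ fM] := CB_cmod_bounded f.
have cfj : continuous (fun x => f (j x)).
  by move=> x; apply: continuous_comp (cj x) _; exact: CB_continuous.
by exists (CB_of cfj (fun x => fM (j x))).
Qed.

Hypothesis dj : dense (range j).

Lemma CB_dense_eq (f g : CB Y R) : (forall x, f (j x) = g (j x)) -> f = g.
Proof.
move=> fg; apply: CBext => y; apply/eqP; rewrite -subr_eq0 -cmod_eq0.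
(* Written as an inequality, the equality becomes a closed condition that passes from the dense
   range to all of [Y]. *)
have -> : (cmod (f y - g y) == 0) = (cmod ((f - g) y) <= 0).
  by rewrite eq_le cmod_ge0 andbT.
have cl : closed [set y | cmod ((f - g) y) <= 0].
  exact: (closed_comp (fun y _ => @CB_cmod_continuous _ _ (f - g) y) (@closed_le _ 0)).
apply: (dense_closed_setT dj cl) => _ [x _ <-].
have : cmod ((f - g) (j x)) == 0 by rewrite cmod_eq0 CB_subE fg subrr.
by move=> /eqP fg0; rewrite /= fg0.
Qed.

Lemma CB_dense_norm (f : CB Y R) (g : CB X R) : (forall x, g x = f (j x)) -> `|f| = `|g|.
Proof.
move=> gf; apply/eqP; rewrite eq_le; apply/andP; split; last first.
  by apply: CBnorm_le => [|x]; [exact: CBnorm_ge0 | rewrite gf; exact: CBnorm_ub].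
apply: CBnorm_le => [|y]; first exact: CBnorm_ge0.
rewrite -[`|g|]ger0_norm ?normr_ge0// !normCE le_cplx_of.
have cl : closed [set y | cmod (f y) <= cmod `|g|].
  exact: (closed_comp (fun y _ => @CB_cmod_continuous _ _ f y) (@closed_le _ _)).
apply: (dense_closed_setT dj cl) => _ [x _ <-] /=.
rewrite -gf -le_cplx_of -!normCE [leRHS]ger0_norm ?normr_ge0//; exact: CBnorm_ub.
Qed.

End DenseMaps.

(** * Separation and compactness in subspaces *)

Section Subspaces.
Variables (T : topologicalType) (A : set T).

Lemma set_val_continuous : continuous (set_val : A -> T).
Proof. exact: initial_continuous. Qed.

Lemma set_type_hausdorff : hausdorff_space T -> hausdorff_space A.
Proof.
move=> hT p q pq; apply: val_inj; apply: hT => U V Up Vq.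
have [r [Ur Vr]] := pq _ _ (@set_val_continuous p _ Up) (@set_val_continuous q _ Vq).
by exists (set_val r).
Qed.

Lemma set_type_compact (K : set T) : compact K -> K `<=` A ->
  compact (set_val @^-1` K : set A).
Proof.
move=> cK KA F FF FK.
have [|p [Kp clp]] := cK (set_val @ F).
  by apply: filterS FK.
exists (SigSub (mem_set (KA _ Kp))); split => // B D FB [_ [[V oV <-] /= Vp] VD].
have [||_ [[a Ba <-] Va]] := clp (set_val @` B) V.
- by apply: (@filterS _ F _ B _ _ FB) => x Bx; exists x.
- by apply: open_nbhs_nbhs; split.
by exists a; split => //; exact: VD.
Qed.

(** A compact Hausdorff space is regular, so each point of [A] has a neighborhood whose closure,
    compact, stays inside [A]. *)
Lemma set_type_locally_compact : hausdorff_space T -> compact [set: T] -> open A ->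
  locally_compact [set: A].
Proof.
move=> hT cT oA y _.
have nA : nbhs (set_val y) A.
  by apply: open_nbhs_nbhs; split => //; exact: (@set_valP _ A y).
have [N nN NA] := compact_regular hT cT filterT nA.
have cN : compact (closure N) by apply: subclosed_compact cT _ => //; exact: closed_closure.
exists (set_val @^-1` closure N : set A).
  have : nbhs y (set_val @^-1` N) by exact: (@set_val_continuous y _ nN).
  rewrite /within /=; apply: filterS => z Nz _; exact: subset_closure.
split; first exact: set_type_compact.
apply: closed_comp (@closed_closure _ N) => z _; exact: set_val_continuous.
Qed.

End Subspaces.

(** * Extending bounded functions to the Stone-Cech compactification *)

Section StoneCechExtension.
Variables (R : realType) (X : topologicalType).
Local Notation C := (Cplx R).
Local Notation S := (stone_cech R X).

Lemma to_stone_cech_continuous : continuous (to_stone_cech R : X -> S).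
Proof. by apply: continuous_to_set_type; exact: unit_eval_continuous. Qed.

Lemma stone_cech_extension_bounded (u : X -> R) (M : R) : continuous u ->
  (forall x, `|u x| <= M) ->
  exists2 g : S -> R, continuous g & forall x, g (to_stone_cech R x) = u x.
Proof.
move=> cu uM.
(* An affine rescaling brings [u] into [0, 1]. The absolute value covers a negative [M], possible
   when [X] is empty; the added 1 covers M = 0. *)
have N0 : 0 < 2 * `|M| + 1 by have := normr_ge0 M; lra.
pose v x := (u x + `|M|) / (2 * `|M| + 1).
have cv : continuous v.
  by move=> x; exact: (cvgM (cvgD (cu x) (cvg_cst _)) (cvg_cst _)).
have [|g cg gv] := @stone_cech_extension R X v.
  split => // _ [x _ <-]; rewrite /= in_itv/= /v.
  have := ler_norm M; have := uM x; rewrite ler_norml => /andP[uM1 uM2] MM.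
  by rewrite ler_pdivrMr// mul1r ler_pdivlMr// mul0r; apply/andP; split; lra.
exists (fun p => g p * (2 * `|M| + 1) - `|M|).
  by move=> p; exact: (cvgB (cvgM (cg p) (cvg_cst _)) (cvg_cst _)).
by move=> x; rewrite gv /v divfK ?gt_eqF// addrK.
Qed.

(** Real and imaginary parts are extended separately; the bound on the modulus is a closed condition
    and survives by density. *)
Lemma CB_stone_cech_extension (f : CB X R) :
  exists F : CB S R, forall x, F (to_stone_cech R x) = f x.
Proof.
have [M M0 fM] := CB_cmod_bounded f.
have part_ext (part : C -> R) : continuous part -> (forall z, `|part z| <= cmod z) ->
    exists2 g : S -> R, continuous g & forall x, g (to_stone_cech R x) = part (f x).
  move=> cp pM; apply: (@stone_cech_extension_bounded _ M).
    by move=> x; apply: continuous_comp (@CB_continuous _ _ f x) _; exact: cp.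
  by move=> x; exact: le_trans (pM _) (fM x).
have [g1 cg1 g1E] := part_ext _ (@Re_continuous R) (@ler_Re_cmod R).
have [g2 cg2 g2E] := part_ext _ (@Im_continuous R) (@ler_Im_cmod R).
pose F p : C := cplx_of (g1 p) + 'i%C * cplx_of (g2 p).
have FE x : F (to_stone_cech R x) = f x by rewrite /F g1E g2E -complexE.
have cF : continuous F.
  have cplx_comp (g : S -> R) : continuous g -> continuous (fun p => cplx_of (g p)).
    by move=> cg p; apply: continuous_comp (cg p) _; exact: cplx_of_continuous.
  by move=> p; exact: (cvgD (cplx_comp _ cg1 p) (cvgM (cvg_cst _) (cplx_comp _ cg2 p))).
have ccF : continuous (fun p => cmod (F p)).
  by move=> p; apply: continuous_comp (cF p) _; exact: cmod_continuous.
have FM p : cmod (F p) <= M.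
  have cl : closed [set p | cmod (F p) <= M].
    exact: (closed_comp (fun p _ => ccF p) (@closed_le _ _)).
  by apply: (dense_closed_setT (@to_stone_cech_dense R X) cl) => _ [x _ <-] /=; rewrite FE.
by exists (CB_of cF FM).
Qed.

End StoneCechExtension.

(** * The space [Y] and the isomorphism with [C0 R Y] *)

Section Lambda.
Variables (R : realType) (X : topologicalType) (I : set_system X).
Local Notation C := (Cplx R).
Local Notation S := (stone_cech R X).
Local Notation e := (@to_stone_cech R X).
Local Notation Y := (set_type (lambda_null R I)).
Hypotheses (hausX : hausdorff_space X) (cregX : completely_regular_space X)
  (idealI : set_ideal I) (nullX : locally_null I).

Lemma lambda_null_open : open (lambda_null R I).
Proof. by apply: bigcup_open => A _; exact: open_interior. Qed.

Lemma lambda_hausdorff : hausdorff_space Y.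
Proof. exact/set_type_hausdorff/stone_cech_hausdorff. Qed.

Lemma lambda_locally_compact : locally_compact [set: Y].
Proof.
apply: set_type_locally_compact; last exact: lambda_null_open.
  exact: stone_cech_hausdorff.
exact: stone_cech_compact.
Qed.

(** The closure of [|f| > r] lies in [|f| >= r], hence in the open set [|f| > r/2], which is part of
    the null set [|f| >= r/2]. *)
Lemma level_set_null_neighborhood (f : CB X R) (r : R) :
  C0_null R I f -> 0 < r -> has_null_neighborhood I (closure [set x | r < cmod (f x)]).
Proof.
move=> /(C0_nullP idealI) If r0; exists [set x | r / 2 <= cmod (f x)].
  by apply: If; rewrite divr_gt0.
apply: (@subset_trans _ [set x | r <= cmod (f x)]).
  rewrite [X in _ `<=` X](closure_id _).1; last exact: closed_cmod_ge.
  by apply: closureS => x /ltW.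
apply: (@subset_trans _ [set x | r / 2 < cmod (f x)]); first by move=> x /=; lra.
by rewrite -open_subsetE; [move=> x /ltW | exact: open_cmod_gt].
Qed.

Lemma extension_level_sub_lambda (f : CB X R) (F : CB S R) (r : R) :
  C0_null R I f -> (forall x, F (e x) = f x) -> 0 < r ->
  [set p | r <= cmod (F p)] `<=` lambda_null R I.
Proof.
move=> If Ff r0 p rp.
have r2 : 0 < r / 2 by rewrite divr_gt0.
pose D := [set x | r / 2 < cmod (f x)].
exists D; [split|].
(* [D] is the cozero set of the positive part of |f| - r/2. *)
- exists (fun x => cplx_of (Num.max (cmod (f x) - r / 2) 0)).
    have cm : continuous (fun x => Num.max (cmod (f x) - r / 2) 0).
      move=> x; apply: (@continuous_max R X (fun x => cmod (f x) - r / 2) (cst 0)).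
        exact: (cvgB (@CB_cmod_continuous _ _ f x) (cvg_cst _)).
      exact: cvg_cst.
    by move=> x; apply: continuous_comp (cm x) _; exact: cplx_of_continuous.
  by apply/seteqP; split => x;
    rewrite /coz /D /= cplx_of_eq0 neq_lt lt_max gt_max ltxx andbF orbF subr_gt0.
- exact: level_set_null_neighborhood If r2.
(* By density of [X], the open set [|F| > r/2] lies in the closure of its trace on [X], which is
   [D]; being open, it lies in the interior. *)
- have : [set q | r / 2 < cmod (F q)] `<=` interior (closure (e @` D)).
    rewrite -open_subsetE; last exact: open_cmod_gt.
    move=> q Fq N nN.
    have nq : nbhs q (N° `&` [set q | r / 2 < cmod (F q)]).
      apply: filterI; first exact: nbhs_interior.
      by apply: open_nbhs_nbhs; split => //; exact: open_cmod_gt.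
    have [||t [[/interior_subset Nx Fx] [x _ xE]]] :=
        @to_stone_cech_dense R X (N° `&` [set q | r / 2 < cmod (F q)]).
    + by exists q; exact: nbhs_singleton nq.
    + by apply: openI; [exact: open_interior | exact: open_cmod_gt].
    exists (e x); split; last by rewrite xE.
    by exists x => //; rewrite /D /= -Ff xE.
  by move: rp => /= rp; apply => /=; lra.
Qed.

Lemma lambda_contains_X (x : X) : lambda_null R I (e x).
Proof.
have [U IU xU] := nullX x.
have nU : nbhs x U by exact: xU.
have [g [Ig gx _]] := C0_null_separates R idealI cregX nU IU.
have [F FE] := CB_stone_cech_extension g.
apply: (extension_level_sub_lambda Ig FE ltr01).
by rewrite /= FE gx cmod1.
Qed.

Definition to_lambda (x : X) : Y := SigSub (mem_set (lambda_contains_X x)).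

Lemma to_lambda_embedding : topological_embedding to_lambda.
Proof.
have [einj eopen] := to_stone_cech_embedding R hausX cregX.
split; first by move=> x y /(congr1 set_val); exact: einj.
rewrite eopen; apply/seteqP; split => U.
  by move=> [V oV <-]; exists (set_val @^-1` V) => //; exists V.
by move=> [_ [V oV <-] <-]; exists V.
Qed.

Lemma to_lambda_continuous : continuous to_lambda.
Proof. by apply: continuous_to_set_type; exact: to_stone_cech_continuous. Qed.

Lemma to_lambda_dense : dense (range to_lambda).
Proof.
move=> O [y Oy] [V oV VE].
have [||t [[Vx Lx] [x _ xE]]] := @to_stone_cech_dense R X (V `&` lambda_null R I).
- exists (set_val y); split; first by move: Oy; rewrite -VE.
  exact: (@set_valP _ (lambda_null R I) y).
- by apply: openI => //; exact: lambda_null_open.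
by exists (to_lambda x); split; [rewrite -VE; move: Vx; rewrite -xE | exists x].
Qed.

(** Subsets of [Y] with null trace on [X] form an ideal, so a local check suffices. Near a point of
    [Y], the trace of the interior of cl e(D) lies in the closure of [D] in [X], because [e] is an
    embedding, and that closure has a null neighborhood. *)
Lemma to_lambda_preimage_compact (K : set Y) : compact K -> I (to_lambda @^-1` K).
Proof.
have [[N0 IN0] IS IU] := idealI.
have [_ eopen] := to_stone_cech_embedding R hausX cregX.
move=> cK; apply: (@compact_locally_in_ideal _ [set A | I (to_lambda @^-1` A)] _ _ cK).
  split; first by exists set0; rewrite /= preimage_set0; exact: IS IN0.
  - by move=> A B AB; apply: IS => x; exact: AB.
  - by move=> A B; rewrite /= preimage_setU; exact: IU.
move=> y _; have [D [_ [U NU DU]] yD] := @set_valP _ (lambda_null R I) y.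
exists (set_val @^-1` interior (closure (e @` D))).
  apply: (@set_val_continuous _ _ y); apply: open_nbhs_nbhs; split => //.
  exact: open_interior.
apply: IS NU => x /interior_subset clx; apply: interior_subset; apply: DU => N.
rewrite nbhsE => -[W [oW Wx] WN].
have [V oV VW] : [set e @^-1` V | V in open] W by rewrite -eopen.
have [|_ [[z Dz <-] Vz]] := clx V.
  by apply: open_nbhs_nbhs; split => //; move: Wx; rewrite -VW.
by exists z; split => //; apply: WN; rewrite -VW.
Qed.

Lemma C0_null_iso_lambda : isometrically_isomorphic (C0_null R I) (C0 R Y).
Proof.
have ex_phi (f : CB X R) : {g : CB Y R |
    (forall x, g (to_lambda x) = f x) /\ (C0_null R I f -> C0 R Y g)}.
  apply: cid; have [F FE] := CB_stone_cech_extension f.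
  have [g gE] := CB_pullback (@set_val_continuous _ (lambda_null R I)) F.
  exists g; split; first by move=> x; rewrite gE -FE.
  move=> If; rewrite C0_nullE; apply/(C0_nullP (@precompact_ideal Y)) => r r0.
  rewrite precompact_closed; last exact: closed_cmod_ge.
  rewrite (_ : [set _ | _] = set_val @^-1` [set p | r <= cmod (F p)]); last first.
    by apply/seteqP; split => y /=; rewrite gE.
  apply: set_type_compact; last exact: extension_level_sub_lambda If FE r0.
  by apply: (subclosed_compact _ (@stone_cech_compact R X)) => //; exact: closed_cmod_ge.
pose phi f := sval (ex_phi f).
have phiE f x : phi f (to_lambda x) = f x := (svalP (ex_phi f)).1 x.
have phiC0 f : C0_null R I f -> C0 R Y (phi f) := (svalP (ex_phi f)).2.
(* [phi f] is determined by its values on the dense image of [X], so the algebraic identities and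
   the norm equality reduce to checks on [X]. *)
have dj := to_lambda_dense.
exists phi; split.
- split.
  + by move=> f /phiC0.
  + move=> f g _ _ fg; apply: CBext => x; by rewrite -(phiE f) fg phiE.
  (* The preimage of [g] is its restriction to [X], whose level sets are traces of compact sets and
     therefore null. *)
  + move=> g Kg; have [f fE] := CB_pullback to_lambda_continuous g.
    exists f; last by apply: (CB_dense_eq dj) => x; rewrite phiE fE.
    apply/(C0_nullP idealI) => r r0.
    rewrite (_ : [set _ | _] = to_lambda @^-1` [set y | r <= cmod (g y)]); last first.
      by apply/seteqP; split => y /=; rewrite fE.
    apply: to_lambda_preimage_compact; rewrite -precompact_closed; last exact: closed_cmod_ge.
    by move: Kg; rewrite C0_nullE => /(C0_nullP (@precompact_ideal Y)); exact.
- by move=> f g _ _; apply: (CB_dense_eq dj) => x; rewrite CB_addE !phiE.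
- by move=> a f _; apply: (CB_dense_eq dj) => x; rewrite CB_scaleE !phiE.
- by move=> f g _ _; apply: (CB_dense_eq dj) => x; rewrite CB_mulE !phiE.
- by move=> f _; apply: (CB_dense_norm dj) => x; rewrite phiE.
Qed.

End Lambda.

(** * Approximation by functions with null-neighborhood supports *)

Section Density.
Variables (R : realType) (X : topologicalType) (I : set_system X).
Local Notation C := (Cplx R).
Hypotheses (idealI : set_ideal I).

Lemma C00_null_sub : C00_null R I `<=` C0_null R I.
Proof.
move=> f [U IU fU]; apply/(C0_nullP idealI) => r r0.
apply: (ideal_subset idealI) IU => x /= rx; apply: interior_subset; apply: fU.
by apply: subset_closure; rewrite /coz /= -cmod_gt0 (lt_le_trans r0).
Qed.

(** The choice w = max(|f| - r, 0) / max(|f|, r) makes |f| - w |f| equal to min(|f|, r), and its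
    denominator is at least [r]. *)
Lemma CB_cutoff (f : CB X R) (r : R) : 0 < r -> exists w : CB X R,
  (forall x, cmod (w x * f x - f x) <= r) /\ coz w `<=` [set x | r < cmod (f x)].
Proof.
move=> r0.
pose w x := Num.max (cmod (f x) - r) 0 / Num.max (cmod (f x)) r.
have den x : 0 < Num.max (cmod (f x)) r by rewrite lt_max r0 orbT.
have cw : continuous w.
  have cs := @CB_cmod_continuous _ _ f.
  move=> x; apply: cvgM.
    apply: (@continuous_max R X (fun x => cmod (f x) - r) (cst 0)).
      exact: (cvgB (cs x) (cvg_cst _)).
    exact: cvg_cst.
  apply: cvgV; first exact/lt0r_neq0/den.
  by apply: (@continuous_max R X (fun x => cmod (f x)) (cst r)); [exact: cs | exact: cvg_cst].
have cW : continuous (fun x => cplx_of (w x)).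
  by move=> x; apply: continuous_comp (cw x) _; exact: cplx_of_continuous.
have w0 x : 0 <= w x by rewrite divr_ge0 ?(ltW (den x))// le_max lexx orbT.
have w1 x : cmod (cplx_of (w x)) <= 1.
  rewrite cmod_cplx_of ger0_norm// ler_pdivrMr// mul1r.
  rewrite ge_max !le_max (ltW r0) lerBlDr lerDl (ltW r0) /=.
  by rewrite orbT.
have wE x : cmod (f x) - w x * cmod (f x) <= r /\ 0 <= cmod (f x) - w x * cmod (f x).
  have s0 := cmod_ge0 (f x); rewrite /w; have [sr|sr] := leP r (cmod (f x)).
    have sx : 0 < cmod (f x) by exact: lt_le_trans sr.
    rewrite max_l ?subr_ge0// divfK ?gt_eqF//; split; lra.
  have sr0 : cmod (f x) - r <= 0 by lra.
  by rewrite max_r// !mul0r subr0; split => //; lra.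
exists (CB_of cW w1); split.
  move=> x; rewrite (_ : _ - _ = cplx_of (w x - 1) * f x); last first.
    by rewrite cplx_ofB mulrBl mul1r.
  rewrite cmodM cmod_cplx_of.
  have [w_le w_ge] := wE x; rewrite -[X in _ * X]ger0_norm ?cmod_ge0// -normrM.
  by rewrite mulrBl mul1r distrC ger0_norm.
move=> x; rewrite /coz /= cplx_of_eq0; apply: contra_neqT; rewrite -leNgt => sr.
by rewrite /w max_r ?subr_le0// mul0r.
Qed.

(** Cutting [f] off at half the radius changes it by at most that much and leaves a support inside
    the closure of [|f| > r], which has a null neighborhood. *)
Lemma C0_null_sub_closure : C0_null R I `<=` closure (C00_null R I).
Proof.
move=> f If N /nbhs_ballP[e /= e0 eN].
have e2 : 0 < complex.Re e / 2 by rewrite divr_gt0// -lt_cplx_of -cplx_of_gt0E.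
have [w [wf wr]] := CB_cutoff f e2.
exists (w * f); split.
  have [U IU DU] := level_set_null_neighborhood idealI If e2.
  exists U => //; apply: subset_trans DU; apply: closureS => x.
  have wfw : (w * f) x != 0 -> w x != 0.
    by apply: contra_neq => wx; rewrite CB_mulE wx mul0r.
  by move=> /wfw; exact: wr.
apply: eN; rewrite -ball_normE /= distrC (cplx_of_gt0E e0).
apply: (@le_lt_trans _ _ (cplx_of (complex.Re e / 2))).
  apply: CBnorm_le => [|x]; first by rewrite -[0]/(cplx_of (0 : R)) le_cplx_of ltW.
  by rewrite normCE le_cplx_of; exact: wf.
rewrite lt_cplx_of; lra.
Qed.

End Density.

Theorem theorem2p2p8 (R : realType) (X : topologicalType) (I : set_system X)
    (hausX : hausdorff_space X) (cregX : completely_regular_space X)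
    (idealI : set_ideal I) (nullX : locally_null I) :
  let H : set (CB X R) := C0_null R I in
  let Y : topologicalType := set_type (lambda_null R I) in
  [/\ algebra_ideal H /\ closed H,
      [/\ hausdorff_space Y, locally_compact [set: Y]
        & isometrically_isomorphic H (C0 R Y)],
      forall Z : topologicalType, hausdorff_space Z ->
        locally_compact [set: Z] -> isometrically_isomorphic H (C0 R Z) ->
        homeomorphic Z Y
    & homeomorphic Y (spectrum H)] /\
  [/\ exists j : X -> Y, [/\ forall x, set_val (j x) = to_stone_cech R x,
        topological_embedding j & dense (range j)],
      non_vanishing H,
      normal_space X ->
        C00_null R I `<=` H /\ H `<=` closure (C00_null R I)
    & [<-> unital H; I [set: X]; compact [set: Y]]].
Proof.
move=> H Y.
have idealH : algebra_ideal H := C0_null_ideal R idealI.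
have hY : hausdorff_space Y := @lambda_hausdorff R X I.
have lY : locally_compact [set: Y] := @lambda_locally_compact R X I.
have isoY : isometrically_isomorphic H (C0 R Y) := C0_null_iso_lambda R hausX cregX idealI nullX.
have specY : homeomorphic Y (spectrum H) := spectrum_homeomorphic idealH hY lY isoY.
have sep x : exists2 h, H h & h x = 1.
  have [U IU xU] := nullX x.
  have nU : nbhs x U by exact: xU.
  by have [g [Ig gx _]] := C0_null_separates R idealI cregX nU IU; exists g.
pose j := to_lambda R cregX idealI nullX.
split; split => //.
- by split => //; exact: C0_null_closed.
(* Both [Z] and [Y] are homeomorphic to the spectrum of [H]. *)
- move=> Z hZ lZ isoZ; apply: homeomorphic_trans (homeomorphic_sym specY).
  exact: spectrum_homeomorphic.
- exists j; split => //; first exact: to_lambda_embedding.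
  exact: to_lambda_dense.
- by move=> x; have [h Hh hx] := sep x; exists h => //; rewrite hx oner_eq0.
- by move=> _; split; [exact: C00_null_sub | exact: C0_null_sub_closure].
- tfae.
  (* Testing a unit against some [h] with h(x) = 1 gives u(x) = 1, so the level set of [u] at
     threshold 1 is all of [X]. *)
  + move=> [u Hu uH]; move: Hu => /(_ 1%N isT); congr I.
    apply/seteqP; split => x //= _; have [h Hh hx] := sep x.
    have := congr1 (fun g : CB X R => g x) (uH h Hh).
    by rewrite CB_mulE hx mulr1 => ->; rewrite normr1 invr1.
  (* The constant 1 is now in [H], and its image is an identity of [C0 R Y], hence 1 at every point;
     its level set at threshold 1 is [Y]. *)
  + move=> IX; have [phi [[phiH _ phi_surj] _ _ phiM _]] := isoY.
    have H1 : H 1 by apply/(C0_nullP idealI) => r _; exact: (ideal_subset idealI) IX.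
    have phi1 y : phi 1 y = 1.
      have [g [Kg gy _]] := C0_separates R hY lY (@filterT _ (nbhs y) _).
      have [h Hh hg] := phi_surj g Kg.
      have := congr1 (fun f : CB Y R => f y) (phiM 1 h H1 Hh).
      by rewrite mul1r CB_mulE hg gy mulr1.
    have := phiH _ H1 1%N isT; congr compact; apply/seteqP; split => y //= _.
    by rewrite phi1 normr1 invr1.
  + move=> cY; have [phi [[phiH phi_inj phi_surj] _ _ phiM _]] := isoY.
    have K1 : C0 R Y 1.
      rewrite C0_nullE; apply/(C0_nullP (@precompact_ideal Y)) => r _.
      rewrite precompact_closed; last exact: closed_cmod_ge.
      by apply: (subclosed_compact _ cY) => //; exact: closed_cmod_ge.
    have [u Hu u1] := phi_surj 1 K1; exists u => // h Hh.
    have Huh : H (u * h) by have [_ _ _ HM] := idealH; exact: HM.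
    by apply: phi_inj; rewrite ?inE// phiM// u1 mul1r.
Qed.
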